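(* Let $f\in\mathbb{R}[t_1,\dots,t_n]$ be a homogeneous polynomial of degree $d\ge2$ with nonnegative coefficients. Then $f$ is Lorentzian if and only if (S2) $\tau\,\mathrm{supp}(f)$ is $H$-connected, and (H1) for any $1\le i_3,\dots,i_d\le n$, the symmetric bilinear form $(\mathbf{x},\mathbf{y})\mapsto D_\mathbf{x}D_\mathbf{y}\partial_{i_3}\cdots\partial_{i_d}f$ has at most one positive eigenvalue.
   Context: $D_\mathbf{u}=\sum u_i\partial_i$, $\partial^\alpha=\prod\partial_i^{\alpha_i}$. A homogeneous $f$ of degree $d\ge2$ is strictly Lorentzian if for all $1\le i_1,\dots,i_d\le n$, $\partial_{i_1}\cdots\partial_{i_d}f>0$ and the bilinear form $(\mathbf{x},\mathbf{y})\mapsto D_\mathbf{x}D_\mathbf{y}\partial_{i_3}\cdots\partial_{i_d}f$ is non-singular with exactly one positive eigenvalue; positive constants and linear forms with positive coefficients are strictly Lorentzian. Lorentzian polynomials are the limits (in the space of degree-$d$ homogeneous polynomials) of strictly Lorentzian ones. $\mathrm{supp}(f)=\{\alpha\in\mathbb{N}^n:\alpha_1+\dots+\alpha_n=d,\ \partial^\alpha f\ne0\}$. For $\mathrm{M}\subset\mathbb{N}^n$ and $\beta\in\mathbb{N}^n$, $\partial^\beta\mathrm{M}=\{\alpha-\beta:\alpha\in\mathrm{M},\ \alpha-\beta\in\mathbb{N}^n\}$, $\partial_i=\partial^{e_i}$, $\tau(\mathrm{M})=\bigcup_j\partial_j(\mathrm{M})$. $\mathrm{M}$ has constant sum $r$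 if $\sum_i\alpha_i=r$ for all $\alpha\in\mathrm{M}$. If $r\ge2$, $\mathrm{M}$ is connected if there is no proper subset $A\subset[n]$ such that $\{\alpha\in\mathrm{M}:\alpha_i=0\ \forall i\in A\}$ and $\{\alpha\in\mathrm{M}:\alpha_i=0\ \forall i\in[n]\setminus A\}$ partition $\mathrm{M}$ into two nonempty sets; if $r\le1$, $\mathrm{M}$ is connected by convention. For $r\ge2$, $\mathrm{M}$ is $H$-connected if $\partial^\alpha\mathrm{M}$ is connected for every $\alpha\in\mathbb{N}^n$ with $|\alpha|\le r-2$ (we take $\mathrm{M}$ with constant sum $\le1$ to be $H$-connected). *)

(* Defs.v *)
From HB Require Import structures.
From mathcomp Require Import all_boot all_order all_algebra.
From mathcomp Require Import classical_sets reals topology normedtype sequences.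
From mathcomp Require Import polyrcf.
(* The notations of [mpoly] clash with those of MathComp-Analysis: exponent
   vectors in N^n are [multinom n], R[t_1, ..., t_n] is [mpoly n R], and
   [mcoeff m f] is the coefficient of the monomial m in f. *)
From mathcomp Require Import -(notations) mpoly.

Set Implicit Arguments.
Unset Strict Implicit.
Unset Printing Implicit Defensive.

Import Order.TTheory GRing.Theory Num.Theory.
Import numFieldNormedType.Exports.

Local Open Scope classical_set_scope.
Local Open Scope ring_scope.

Section Lorentzian.
Context {R : realType} {n : nat}.
Implicit Types (f g : mpoly n R) (d : nat) (u x y : 'rV[R]_n).

Definition homogeneous d f : Prop := f \is ishomog1 d mdeg.

Definition dirderiv u f : mpoly n R := \sum_(i < n) u 0 i *: mderiv i f.

Definition pderivs (s : seq 'I_n) f : mpoly n R := foldr (@mderiv n R) f s.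

(* [g] is meant to be homogeneous of degree 2, so that D_x D_y g is a constant
   polynomial; [mcoeff mnm0] reads off its value. *)
Definition second_form g x y : R :=
  mcoeff (@mnm0 n) (dirderiv x (dirderiv y g)).

Definition second_form_mx g : 'M[R]_n := matrix_of_form (second_form g).

(* Algebraic multiplicities are counted. *)
Definition num_pos_eigenvalues m (A : 'M[R]_m) : nat :=
  (\sum_(a <- rootsR (char_poly A) | (0 < a)%R) mup a (char_poly A))%N.

(* For d = 0 and d = 1 the second clause is void, and the first one describes
   the positive constants and the linear forms with positive coefficients. *)
Definition strictly_lorentzian d f : Prop :=
  [/\ homogeneous d f,
      forall i : d.-tuple 'I_n, 0 < mcoeff (@mnm0 n) (pderivs i f)
    & (2 <= d)%N -> forall i : (d - 2).-tuple 'I_n,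
        second_form_mx (pderivs i f) \in unitmx /\
        num_pos_eigenvalues (second_form_mx (pderivs i f)) = 1%N].

(* Convergence in the finite-dimensional space of homogeneous polynomials of
   degree d is convergence of every coefficient. *)
Definition lorentzian d f : Prop :=
  homogeneous d f /\
  exists F : nat -> mpoly n R,
    (forall k, strictly_lorentzian d (F k)) /\
    (forall m : multinom n, mcoeff m (F k) @[k --> \oo] --> mcoeff m f).

Definition supp d f : set (multinom n) :=
  [set a | mdeg a = d /\ mderivm a f <> 0].

End Lorentzian.

Section Connected.
Context {n : nat}.
Implicit Types (M : set (multinom n)) (a b : multinom n) (r : nat).

(* The subtraction [mnm_sub] is truncated, hence the guard [lem b a]. *)
Definition set_deriv b M : set (multinom n) :=
  [set mnm_sub a b | a in [set a | M a /\ lem b a]].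

Definition tau M : set (multinom n) :=
  \bigcup_(j : 'I_n) set_deriv (mnm1 j) M.

Definition constant_sum r M : Prop := forall a, M a -> mdeg a = r.

Definition vanishing_on (A : set 'I_n) M : set (multinom n) :=
  [set a | M a /\ forall i, A i -> a i = 0%N].

(* The constant sum r is determined by M unless M is empty; the empty set is
   connected and H-connected for every r. *)
Definition set_connected M : Prop :=
  exists r, constant_sum r M /\
    ((2 <= r)%N ->
     ~ exists A : set 'I_n,
         [/\ A `<` setT,
             vanishing_on A M !=set0,
             vanishing_on (~` A) M !=set0,
             vanishing_on A M `&` vanishing_on (~` A) M = set0
           & vanishing_on A M `|` vanishing_on (~` A) M = M]).

Definition H_connected M : Prop :=
  exists r, constant_sum r M /\
    ((2 <= r)%N ->
     forall a, (mdeg a <= r - 2)%N -> set_connected (set_deriv a M)).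

End Connected.

(* Main.v *)
(* Write c(m) = m! f_m for the normalized coefficients of f, so that partial
   derivatives translate c and D_v becomes (D_v c)(m) = sum_i v_i c(m + e_i).
   A form B has at most one positive eigenvalue iff it satisfies the reverse
   Cauchy-Schwarz inequality B(x,x) B(y,y) <= B(x,y)^2 whenever B(x,x) > 0,
   a condition that passes to limits.

   The heart is a local-to-global principle: if T is a symmetric trilinear
   form with nonnegative entries, each T(.,.,e_i) has at most one positive
   eigenvalue, v > 0 and the matrix of T(.,.,v) is connected, then T(.,.,v)
   has at most one positive eigenvalue. By induction, all the forms
   D_x D_y D_{v_1} ... D_{v_k} d^m f with v_j > 0 and |m| + k = d - 2 inherit
   the property from the case k = 0; for k > 0 connectedness of the matrix of
   such a form is exactly connectedness of d^m (tau (supp f)).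

   Necessity: these forms, for strictly Lorentzian approximants (where all the
   matrices are positive) and then for their limit f, satisfy reverse
   Cauchy-Schwarz, which forces their matrices to be connected.
   Sufficiency: compose f with the linear map sending e_i to e_i + delta
   (1, ..., 1) to get positive coefficients, then subtract epsilon times
   a sum of powers of positive linear forms spanning the dual space. The
   second order forms of the subtracted polynomial are positive definite, so
   at most one eigenvalue stays positive, and for all small epsilon > 0 the
   forms become non-singular. *)
Require Import Defs.
From HB Require Import structures.
From mathcomp Require Import all_boot all_order all_algebra.
From mathcomp Require Import zify ring lra.
From mathcomp Require Import boolp classical_sets reals topology normedtype.
From mathcomp Require Import sequences.
From mathcomp Require Import polyrcf.
From mathcomp Require Import -(notations) complex.
From mathcomp Require Import -(notations) mpoly.

Set Implicit Arguments.
Unset Strict Implicit.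
Unset Printing Implicit Defensive.

Import Order.TTheory GRing.Theory Num.Theory.
Import numFieldNormedType.Exports.

Local Open Scope classical_set_scope.
Local Open Scope ring_scope.

Local Notation "a +m b" := (mnm_add a b) (at level 50, left associativity).

(** * Orthonormal diagonalization of real symmetric matrices *)

(** The spectral theorem for hermitian matrices applies over [complex R]; the eigenvalues are real,
    and real matrices similar over [complex R] are similar over [R]. The conjugating [P] obtained
    this way is only invertible. *)
Lemma symmetric_diagonalizable (R : rcfType) n (A : 'M[R]_n) : A^T = A ->
  exists P : 'M[R]_n, exists D : 'rV[R]_n,
    P \in unitmx /\ P *m A = diag_mx D *m P.
Proof.
move=> symA; pose toC : {rmorphism R -> complex R} := real_complex R.
have toC_real m k (B : 'M[R]_(m, k)) : map_mx toC B \is a mxOver Num.real.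
  by apply/mxOverP => i j; rewrite mxE; apply/complex_realP; exists (B i j).
pose Ac := map_mx toC A.
have symAc : Ac \is symmetricmx.
  apply/is_hermitianmxP; rewrite expr0 scale1r /Ac.
  by apply/matrixP => i j; rewrite !mxE -[in LHS]symA mxE.
have hermAc := realsym_hermsym symAc (toC_real _ _ A).
have /orthomx_spectralP eqAc := hermitian_normalmx hermAc.
have /mxOverP realD := hermitian_spectral_diag_real hermAc.
pose D : 'rV[R]_n := \row_j complex.Re (spectral_diag Ac 0 j).
have eqD : map_mx toC D = spectral_diag Ac.
  by apply/rowP => j; rewrite !mxE; apply: RRe_real; apply: realD.
have : similar_in unitmx Ac (map_mx toC (diag_mx D)).
  exists (spectralmx Ac); first exact: spectral_unit.
  apply/similarP; first exact: spectral_unit.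
  rewrite map_diag_mx eqD; move: eqAc (spectral_unit Ac).
  move: (spectralmx Ac) (spectral_diag Ac) => U E eqU unitU.
  by rewrite eqU !mulmxA mulmxV // mul1mx.
move=> /real_similar /(_ (toC_real _ _ _) (toC_real _ _ _)) [Q].
rewrite inE => /andP[realQ unitQ] /(similarP unitQ) QA.
pose P := map_mx (@complex.Re R) Q.
have eqP : map_mx toC P = Q.
  apply/matrixP => i j; rewrite !mxE; apply: RRe_real.
  by move/mxOverP: realQ; apply.
exists P, D; split; first by rewrite -(map_unitmx toC) eqP.
by apply: (@map_mx_inj _ _ toC); rewrite !map_mxM eqP.
Qed.

Section RealSpectral.
Variable R : rcfType.

Lemma dot_self_ge0 n (v : 'rV[R]_n) : 0 <= (v *m v^T) 0 0.
Proof.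
by rewrite mxE sumr_ge0 // => i _; rewrite mxE -expr2 sqr_ge0.
Qed.

Lemma dot_self_eq0 n (v : 'rV[R]_n) : ((v *m v^T) 0 0 == 0) = (v == 0).
Proof.
apply/idP/eqP => [|->]; last by rewrite mul0mx mxE.
rewrite mxE psumr_eq0 => [/allP v0|i _]; last by rewrite mxE -expr2 sqr_ge0.
apply/rowP => i; rewrite [RHS]mxE.
by have := v0 i (mem_index_enum i); rewrite mxE -expr2 sqrf_eq0 => /eqP.
Qed.

(** Gram-Schmidt among eigenvectors: some row of [P] lies outside the row span of [Q]. Since [A]
    commutes with the projection [Q^T *m Q], subtracting the projected part leaves an eigenvector
    for the same eigenvalue. *)
Lemma partial_orthonormal_eigenbasis n (A P : 'M[R]_n) (D : 'rV_n) :
  A^T = A -> P \in unitmx -> P *m A = diag_mx D *m P ->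
  forall k, (k <= n)%N -> exists Q : 'M_(k, n), exists E : 'rV_k,
    Q *m Q^T = 1%:M /\ Q *m A = diag_mx E *m Q.
Proof.
move=> symA unitP PA; elim=> [|k IHk] lekn.
  by exists 0, 0; split; apply/matrixP => -[].
have [Q [E [QQ QA]]] := IHk (ltnW lekn).
have /row_subPn[i PiQ] : ~~ (P <= Q)%MS.
  apply/negP => /mxrankS; rewrite mxrank_unit // => /leq_trans.
  by move=> /(_ _ (rank_leq_row Q)); rewrite leqNgt lekn.
set v := row i P in PiQ.
have vA : v *m A = D 0 i *: v.
  by rewrite /v -row_mul PA row_mul row_diag_mx -scalemxAl -rowE.
pose v' := v - v *m Q^T *m Q.
have v'0 : v' != 0.
  rewrite subr_eq0; apply: contraNneq PiQ => ->.
  exact: submxMl.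
have AQ : A *m Q^T = Q^T *m diag_mx E.
  by rewrite -[A]symA -trmx_mul QA trmx_mul tr_diag_mx.
have v'A : v' *m A = D 0 i *: v'.
  rewrite mulmxBl vA scalerBr -(mulmxA _ Q) QA mulmxA -(mulmxA v) -AQ.
  by rewrite mulmxA vA -!scalemxAl.
have v'Q : v' *m Q^T = 0.
  by rewrite mulmxBl -!mulmxA QQ mulmx1 subrr.
pose s := Num.sqrt ((v' *m v'^T) 0 0).
have s2 : s ^+ 2 = (v' *m v'^T) 0 0 by rewrite sqr_sqrtr // dot_self_ge0.
have s0 : s != 0 by rewrite -sqrf_eq0 s2 dot_self_eq0.
pose w := s^-1 *: v'.
have ww : w *m w^T = 1%:M.
  rewrite [LHS]mx11_scalar; congr (_%:M).
  rewrite /w linearZ /= -scalemxAl -scalemxAr scalerA mxE -s2.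
  by rewrite -invfM -expr2 mulVf // sqrf_eq0.
have wQ : w *m Q^T = 0 by rewrite -scalemxAl v'Q scaler0.
have wA : w *m A = D 0 i *: w by rewrite -scalemxAl v'A scalerA mulrC -scalerA.
have QQ' : col_mx w Q *m (col_mx w Q)^T = 1%:M.
  rewrite tr_col_mx mul_col_row ww wQ QQ.
  have -> : Q *m w^T = 0 by rewrite -[LHS]trmxK trmx_mul trmxK wQ trmx0.
  by rewrite -scalar_mx_block.
have QA' : col_mx w Q *m A = diag_mx (row_mx (D 0 i)%:M E) *m col_mx w Q.
  rewrite diag_mx_row mul_block_col mul_col_mx wA QA !mul0mx addr0 add0r.
  have -> : diag_mx (D 0 i)%:M = (D 0 i)%:M :> 'M_1.
    by apply/matrixP => a b; rewrite !ord1 !mxE !eqxx.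
  by rewrite mul_scalar_mx.
by exists (col_mx w Q), (row_mx (D 0 i)%:M E).
Qed.

Theorem real_spectral n (A : 'M[R]_n) : A^T = A ->
  exists P : 'M[R]_n, exists D : 'rV[R]_n,
    P *m P^T = 1%:M /\ A = P^T *m diag_mx D *m P.
Proof.
move=> symA; have [P0 [D0 [unitP0 PA0]]] := symmetric_diagonalizable symA.
have [P [D [PP PA]]] :=
  partial_orthonormal_eigenbasis symA unitP0 PA0 (leqnn n).
exists P, D; split=> //; rewrite -mulmxA -PA mulmxA.
by rewrite (mulmx1C PP) mul1mx.
Qed.

End RealSpectral.

(** * Eigenvalue counts from a spectral decomposition *)

Lemma char_poly_spectral (R : comUnitRingType) n (P : 'M[R]_n) (D : 'rV_n) :
  P *m P^T = 1%:M ->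
  char_poly (P^T *m diag_mx D *m P) = \prod_(i < n) ('X - (D 0 i)%:P).
Proof.
move=> PP.
have <- : char_poly (diag_mx D) = \prod_(i < n) ('X - (D 0 i)%:P).
  rewrite char_poly_trig ?diag_mx_is_trig //.
  by apply: eq_bigr => i _; rewrite mxE eqxx.
pose Q := map_mx (@polyC R) P.
have QQ : Q^T *m Q = 1%:M by rewrite map_trmx -map_mxM (mulmx1C PP) map_mx1.
rewrite /char_poly /char_poly_mx !map_mxM -map_trmx -/Q.
have eqX : 'X%:M = Q^T *m 'X%:M *m Q.
  by rewrite -mulmxA mul_scalar_mx -scalemxAr QQ scalemx1.
rewrite {1}eqX -mulmxBl -mulmxBr !det_mulmx mulrAC -det_mulmx QQ det1.
by rewrite mul1r.
Qed.

(** Double counting: the multiplicity of a root [a] is the number of indices [i] with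
    [D 0 i = a]. *)
Lemma num_pos_spectral (R : realType) n (P : 'M[R]_n) (D : 'rV_n) :
  P *m P^T = 1%:M ->
  num_pos_eigenvalues (P^T *m diag_mx D *m P) = #|[pred i | 0 < D 0 i]|.
Proof.
move=> PP; rewrite /num_pos_eigenvalues (char_poly_spectral _ PP).
set s := [seq D 0 i | i : 'I_n].
have -> : \prod_(i < n) ('X - (D 0 i)%:P) = \prod_(x <- s) ('X - x%:P).
  by rewrite big_map big_enum.
under eq_bigr do rewrite mu_prod_XsubC.
have p_n0 : \prod_(x <- s) ('X - x%:P) != 0.
  by rewrite monic_neq0 // monic_prod_XsubC.
set r := rootsR _.
have uniq_r : uniq r by rewrite uniq_roots.
have mem_r x : x \in s -> x \in r.
  by move=> xs; rewrite -(roots_on_rootsR p_n0) inE /= root_prod_XsubC.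
under eq_bigr do rewrite -sum1_count big_map big_enum_cond /=.
rewrite (exchange_big_dep predT) //= -sum1_card [RHS]big_mkcond /=.
apply: eq_bigr => i _; rewrite unfold_in /=.
have Dr : D 0 i \in r by apply: mem_r; apply: map_f; rewrite mem_enum.
under eq_bigl => a do rewrite eq_sym.
case: ifPn => [Di|nDi]; last first.
  by rewrite big1_seq // => a /andP[/andP[a0 /eqP aD]]; rewrite -aD a0 in nDi.
rewrite sum1_count (@eq_count _ _ (pred1 (D 0 i))) => [|a /=].
  by rewrite count_uniq_mem // Dr.
by case: eqVneq => [->|]; rewrite ?andbF ?andbT.
Qed.

(** * Symmetric forms with at most one positive eigenvalue *)

Section SymmetricForms.
Variables (R : realType) (n : nat).
Implicit Types (A : 'M[R]_n) (x y p : 'rV[R]_n).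

Definition dot x y : R := \sum_i x 0 i * y 0 i.

Definition bform A x y : R := \sum_i \sum_j x 0 i * A i j * y 0 j.

Definition lorentzian_form (B : 'rV[R]_n -> 'rV[R]_n -> R) : Prop :=
  forall x y, 0 < B x x -> B x x * B y y <= B x y ^+ 2.

Lemma bformC A x y : A^T = A -> bform A x y = bform A y x.
Proof.
move=> symA; rewrite /bform exchange_big; apply: eq_bigr => i _.
by apply: eq_bigr => j _; rewrite -[in LHS]symA mxE mulrC mulrA mulrAC mulrC !mulrA.
Qed.

Lemma bformBZl A x y z a : bform A (x - a *: y) z = bform A x z - a * bform A y z.
Proof.
rewrite /bform mulr_sumr -sumrB; apply: eq_bigr => i _.
rewrite mulr_sumr -sumrB; apply: eq_bigr => j _.
by rewrite !mxE; ring.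
Qed.

Lemma bformBZ A x y a : A^T = A ->
  bform A (x - a *: y) (x - a *: y) =
  bform A x x - 2 * a * bform A x y + a ^+ 2 * bform A y y.
Proof.
move=> symA; rewrite bformBZl !(bformC _ (x - _) symA) !bformBZl.
by rewrite (bformC y x symA); ring.
Qed.

(** The vector [y] is moved along [x] into the hyperplane orthogonal to [p], where the form is
    nonpositive. *)
Lemma lorentzian_hyperplane A p : A^T = A ->
  (forall y, dot y p = 0 -> bform A y y <= 0) -> lorentzian_form (bform A).
Proof.
move=> symA negA x y Qx.
have xp : dot x p != 0 by apply: contraTneq Qx => /negA; rewrite leNgt.
have := negA (y - (dot y p / dot x p) *: x).
have -> : dot (y - (dot y p / dot x p) *: x) p = 0.
  have dotB t : dot (y - t *: x) p = dot y p - t * dot x p.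
    rewrite /dot mulr_sumr -sumrB; apply: eq_bigr => i _; rewrite !mxE; ring.
  by rewrite dotB divfK // subrr.
move=> /(_ erefl); rewrite bformBZ // (bformC y x symA).
move: (dot y p / _) (bform A x x) (bform A y y) (bform A x y) Qx.
move=> t a b c a0 le0.
(* The left side equals a b - c^2 + (c - t a)^2. *)
suff : a * (b - 2 * t * c + t ^+ 2 * a) <= 0.
  have := sqr_ge0 (c - t * a); rewrite sqrrB exprMn; lra.
by rewrite pmulr_rle0.
Qed.

Lemma spectral_coordinates A : A^T = A ->
  exists P : 'M[R]_n, exists D : 'rV[R]_n,
  [/\ P *m P^T = 1%:M, A = P^T *m diag_mx D *m P,
      forall a b, dot (row a P) (row b P) = (a == b)%:R,
      forall x y, bform A x y =
        \sum_a D 0 a * dot x (row a P) * dot y (row a P)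
    & forall a j, \sum_i P a i * A i j = D 0 a * P a j].
Proof.
move=> symA; have [P [D [PP eqA]]] := real_spectral symA.
exists P, D; split=> //.
- move=> a b; have /matrixP/(_ a b) := PP; rewrite !mxE => <-.
  by apply: eq_bigr => i _; rewrite !mxE.
- move=> x y.
  have eqAij i j : A i j = \sum_a D 0 a * P a i * P a j.
    rewrite {1}eqA mxE; apply: eq_bigr => a _; congr (_ * _).
    rewrite mxE (bigD1 a) //= big1 ?addr0 => [|b /negPf ba].
      by rewrite !mxE eqxx mulr1n mulrC.
    by rewrite !mxE ba mulr0n mulr0.
  rewrite /bform.
  transitivity (\sum_i \sum_j \sum_a x 0 i * (D 0 a * P a i * P a j) * y 0 j).
    apply: eq_bigr => i _; apply: eq_bigr => j _.
    by rewrite eqAij mulr_sumr mulr_suml.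
  under eq_bigr do rewrite exchange_big /=.
  rewrite exchange_big /=; apply: eq_bigr => a _.
  rewrite -mulrA /dot mulr_suml mulr_sumr; apply: eq_bigr => i _.
  rewrite !mulr_sumr; apply: eq_bigr => j _; rewrite !mxE; ring.
- move=> a j; have : P *m A = diag_mx D *m P.
    by rewrite eqA !mulmxA PP mul1mx.
  by move=> /matrixP/(_ a j); rewrite mxE => ->; rewrite mul_diag_mx mxE.
Qed.

(** With at most one positive eigenvalue, the form is nonpositive on the hyperplane orthogonal to
    its eigenvector. Conversely, two orthonormal eigenvectors with positive eigenvalues pair to 0,
    against reverse Cauchy-Schwarz. *)
Lemma num_pos_le1P A : A^T = A ->
  (num_pos_eigenvalues A <= 1)%N <-> lorentzian_form (bform A).
Proof.
move=> symA; have [P [D [PP eqA orthP QA _]]] := spectral_coordinates symA.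
rewrite {1}eqA num_pos_spectral //; split=> [le1|lorA].
  pose p := if [pick a | 0 < D 0 a] is Some a then row a P else 0.
  apply: (@lorentzian_hyperplane _ p) => // y yp; rewrite QA.
  apply: sumr_le0 => a _; rewrite -mulrA -expr2.
  case: (leP (D 0 a) 0) => [Da|Da]; first by rewrite mulr_le0_ge0 ?sqr_ge0.
  move: yp; rewrite /p; case: pickP => [b Db|/(_ a)]; last by rewrite Da.
  have -> : b = a by apply: (card_le1_eqP le1).
  by move=> ->; rewrite expr0n mulr0.
rewrite leqNgt; apply/negP => /card_gt1P[a [b [Da Db ab]]].
have Qrow c d : bform A (row c P) (row d P) = D 0 c * (c == d)%:R.
  rewrite QA (bigD1 c) //= orthP eqxx mulr1 orthP eq_sym big1 ?addr0 // => e ec.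
  by rewrite orthP eq_sym (negPf ec) mulr0 mul0r.
have := lorA (row a P) (row b P).
rewrite !Qrow !eqxx (negPf ab) !mulr1 mulr0 expr0n /= => /(_ Da).
by rewrite leNgt mulr_gt0.
Qed.

Lemma num_pos_gt0 A x : A^T = A -> 0 < bform A x x ->
  (0 < num_pos_eigenvalues A)%N.
Proof.
move=> symA; have [P [D [PP eqA _ QA _]]] := spectral_coordinates symA.
rewrite {2}eqA num_pos_spectral // QA lt0n; apply: contraTneq => /card0_eq D0.
rewrite -leNgt sumr_le0 // => a _; rewrite -mulrA -expr2 mulr_le0_ge0 ?sqr_ge0 //.
by rewrite leNgt; have := D0 a; rewrite inE => ->.
Qed.

(** For symmetric [A], the graph with an edge or loop where [0 < A i j] has at most one component
    containing an edge. Isolated indices are ignored, so null rows are harmless. *)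
Definition connected_matrix A : Prop := forall S : pred 'I_n,
  (exists i j, [/\ S i, S j & 0 < A i j]) ->
  (exists i j, [/\ ~~ S i, ~~ S j & 0 < A i j]) ->
  exists i j, [/\ S i, ~~ S j & 0 < A i j].

(* Scaling by s = sqrt (v / Av) turns A into N with N <= N^2 (the hypothesis)
   and N <= 1 (a Dirichlet form is nonnegative), so that the only possible
   positive eigenvalue of N is 1, and connectedness makes it simple. *)
Lemma lorentzian_local_to_global A (v : 'rV[R]_n) : A^T = A ->
  (forall i j, 0 <= A i j) -> (forall i, 0 < v 0 i) -> connected_matrix A ->
  (forall x, bform A x x <=
    \sum_i v 0 i / (v *m A) 0 i * (x *m A) 0 i ^+ 2) ->
  lorentzian_form (bform A).
Proof.
move=> symA A0 v0 connA leA.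
have symAij i j : A i j = A j i by rewrite -{1}symA mxE.
(* Division by 0 yields 0, so [r i = 0] gives [s i = 0]; row [i] of [A] is then null and the scaling
   loses nothing. *)
pose r i := (v *m A) 0 i; pose s i := Num.sqrt (v 0 i / r i).
have r0 i : 0 <= r i.
  by rewrite /r mxE sumr_ge0 // => j _; rewrite mulr_ge0 // ltW.
have s2 i : s i ^+ 2 = v 0 i / r i by rewrite sqr_sqrtr // divr_ge0 // ltW.
have s_eq0 i : s i = 0 -> r i = 0.
  move=> si0; have := s2 i; rewrite si0 expr0n /= => /esym/eqP.
  by rewrite mulf_eq0 gt_eqF //= invr_eq0 => /eqP.
have r_eq0 i j : r i = 0 -> A j i = 0.
  move=> /eqP; rewrite /r mxE psumr_eq0 => [/allP/(_ j)|k _]; last first.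
    by rewrite mulr_ge0 // ltW.
  by rewrite mem_index_enum => /(_ isT); rewrite mulf_eq0 gt_eqF //= => /eqP.
have sA i j : A i j = (s i)^-1 * s i * A i j * s j * (s j)^-1.
  have [si|si] := eqVneq (s i) 0.
    by rewrite (symAij i j) (r_eq0 i j (s_eq0 i si)) !(mulr0, mul0r).
  have [sj|sj] := eqVneq (s j) 0.
    by rewrite (r_eq0 j i (s_eq0 j sj)) !(mulr0, mul0r).
  by field; rewrite si sj.
pose N : 'M[R]_n := \matrix_(i, j) (s i * A i j * s j).
have symN : N^T = N by apply/matrixP => i j; rewrite !mxE symAij; ring.
pose sc x : 'rV[R]_n := \row_i ((s i)^-1 * x 0 i).
have bformN x y : bform A x y = bform N (sc x) (sc y).
  apply: eq_bigr => i _; apply: eq_bigr => j _.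
  by rewrite !mxE [in LHS]sA; ring.
suff lorN : lorentzian_form (bform N).
  by move=> x y; rewrite !bformN; apply: lorN.
have [P [D [_ _ orthP QN eigN]]] := spectral_coordinates symN.
(* [sc v] is fixed by [N]. The goal becomes that each eigenvector of [N] with positive eigenvalue is
   proportional to it. *)
apply: (@lorentzian_hyperplane _ (sc v)) => // y yv; rewrite QN.
apply: sumr_le0 => a _; rewrite -mulrA -expr2.
case: (leP (D 0 a) 0) => [Da|Da]; first by rewrite mulr_le0_ge0 ?sqr_ge0.
have {orthP} norm_a : \sum_i P a i ^+ 2 = 1.
  transitivity (dot (row a P) (row a P)); last by rewrite orthP eqxx.
  by apply: eq_bigr => i _; rewrite !mxE expr2.
pose x : 'rV[R]_n := \row_i (s i * P a i).
have eig j : s j * (x *m A) 0 j = D 0 a * P a j.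
  rewrite -eigN mxE mulr_sumr; apply: eq_bigr => i _; rewrite !mxE; ring.
have Qx : bform A x x = D 0 a.
  rewrite /bform exchange_big /= -[RHS]mulr1 -norm_a mulr_sumr.
  apply: eq_bigr => j _.
  rewrite -mulr_suml; have := eig j; rewrite mxE => eigj.
  by rewrite mxE mulrA expr2 [RHS]mulrA -eigj; ring.
(* This is the hypothesis [leA] at [x]; it gives [1 <= D 0 a]. *)
have Da2 : D 0 a <= D 0 a ^+ 2.
  rewrite -{1}Qx; apply: le_trans (leA x) _.
  rewrite -[leRHS]mulr1 -norm_a mulr_sumr ler_sum // => i _.
  by rewrite -s2 -!exprMn eig.
have Px0 i : s i = 0 -> P a i = 0.
  move=> si; have := eig i; rewrite si mul0r => /esym/eqP.
  by rewrite mulf_eq0 gt_eqF //= => /eqP.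
pose z i := x 0 i / v 0 i.
have Px i : P a i = (s i)^-1 * v 0 i * z i.
  have [si|si] := eqVneq (s i) 0; first by rewrite Px0 // si invr0 !mul0r.
  rewrite /z mxE; field; rewrite si gt_eqF //.
(* With [rx] below, the Dirichlet form of [z] equals 2 (1 - [D 0 a]). It is nonnegative, so it
   vanishes, and [z] is constant along edges. *)
have dirichlet : \sum_i \sum_j A i j * v 0 i * v 0 j * (z i - z j) ^+ 2 =
    2 * (\sum_i r i / v 0 i * x 0 i ^+ 2 - D 0 a).
  have termE i j : A i j * v 0 i * v 0 j * (z i - z j) ^+ 2 =
      v 0 j * A j i * (x 0 i ^+ 2 / v 0 i) + v 0 i * A i j * (x 0 j ^+ 2 / v 0 j)
      - 2 * (x 0 i * A i j * x 0 j).
    rewrite (symAij j i) /z; field; rewrite !gt_eqF //.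
  under eq_bigr do under eq_bigr do rewrite termE.
  have rE i : \sum_j v 0 j * A j i * (x 0 i ^+ 2 / v 0 i) =
     r i / v 0 i * x 0 i ^+ 2.
    have -> : r i = \sum_j v 0 j * A j i by rewrite /r mxE.
    by rewrite -mulr_suml -mulrA; congr (_ * _); rewrite mulrC.
  under eq_bigr do rewrite sumrB big_split /= -mulr_sumr.
  rewrite sumrB big_split /= -mulr_sumr -/(bform A x x) Qx.
  under eq_bigr do rewrite rE.
  rewrite [X in _ + X - _]exchange_big /=.
  under [X in _ + X - _]eq_bigr do rewrite rE.
  ring.
have term_ge0 i j : 0 <= A i j * v 0 i * v 0 j * (z i - z j) ^+ 2.
  by rewrite mulr_ge0 ?sqr_ge0 // !mulr_ge0 // ltW.
have rx : \sum_i r i / v 0 i * x 0 i ^+ 2 = 1.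
  rewrite -norm_a; apply: eq_bigr => i _.
  have [si|si] := eqVneq (s i) 0; first by rewrite s_eq0 // Px0 // !mul0r expr0n.
  rewrite mxE exprMn s2; have ri : r i != 0.
    by apply: contra_neq si => ri; rewrite /s ri invr0 mulr0 sqrtr0.
  by field; rewrite ri gt_eqF.
have E0 : \sum_i \sum_j A i j * v 0 i * v 0 j * (z i - z j) ^+ 2 = 0.
  apply/eqP; rewrite eq_le; apply/andP; split; last first.
    by apply: sumr_ge0 => i _; apply: sumr_ge0.
  rewrite dirichlet rx.
  have : 1 <= D 0 a by move: Da2; rewrite expr2 ler_pMl.
  lra.
have Az i j : 0 < A i j -> z i = z j.
  move=> Aij; move: E0 => /eqP; rewrite psumr_eq0 => [/allP/(_ i)|k _]; last first.
    exact: sumr_ge0.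
  rewrite mem_index_enum psumr_eq0 // => /(_ isT)/allP/(_ j).
  rewrite mem_index_enum => /(_ isT).
  rewrite mulf_eq0 sqrf_eq0 subr_eq0 gt_eqF /= => [/eqP //|].
  by rewrite !mulr_gt0.
have Arow i : s i != 0 -> exists j, 0 < A i j.
  move=> si; apply/existsP; apply: contraNT si; rewrite negb_exists => /forallP si.
  suff ri : r i = 0 by rewrite /s ri invr0 mulr0 sqrtr0.
  rewrite /r mxE big1 // => j _; have /eqP -> : A j i == 0; rewrite ?mulr0 //.
  by rewrite symAij eq_le A0 andbT leNgt.
(* Otherwise the level set of [z] through [i] and its complement both contain an edge, and a
   crossing edge would join different values of [z]. *)
have z_const i j : s i != 0 -> s j != 0 -> z i = z j.
  move=> /Arow[i' Aii'] /Arow[j' Ajj']; apply/eqP; apply: contraT => zij.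
  have [||k [l [/= /eqP zk zl /Az]]] := connA [pred k | z k == z i].
  - by exists i, i'; rewrite /= (Az _ _ Aii').
  - by exists j, j'; rewrite /= -(Az _ _ Ajj') eq_sym.
  by rewrite zk => zkl; rewrite zkl eqxx in zl.
have [kappa eqP] : exists kappa, forall i, P a i = kappa * sc v 0 i.
  case: (pickP [pred i | s i != 0]) => [i0 si0|s0].
    exists (z i0) => i; rewrite Px mxE.
    have [si|si] := eqVneq (s i) 0; first by rewrite si invr0 !(mulr0, mul0r).
    by rewrite (z_const i i0) // mulrC.
  exists 0 => i; have /= := s0 i => /negbFE/eqP si.
  by rewrite Px si invr0 !mul0r.
suff -> : dot y (row a P) = 0 by rewrite expr0n mulr0.
rewrite -[RHS](mulr0 kappa) -yv mulr_sumr; apply: eq_bigr => i _.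
by rewrite mxE eqP; ring.
Qed.

End SymmetricForms.

(** * Splitting exponent vectors *)

Section Multinoms.
Variable n : nat.
Implicit Types (m a b : multinom n).

Lemma mnm_addAC a b m : a +m b +m m = a +m m +m b.
Proof. by rewrite -!addmA (addmC b). Qed.

Lemma mnm_pos_split b i : (0 < b i)%N -> exists b', b = mnm1 i +m b'.
Proof.
move=> bi; exists (mnm_sub b (mnm1 i)).
by rewrite addmC submK // lep1mP -lt0n.
Qed.

Lemma mdeg_gt0_split b : (0 < mdeg b)%N -> exists i b', b = mnm1 i +m b'.
Proof.
move=> b0; have /existsP[i bi] : [exists i, (0 < b i)%N].
  apply: contraLR b0; rewrite negb_exists -eqn0Ngt mdegE => /forallP b0.
  by apply/eqP; rewrite big1 // => i _; apply/eqP; rewrite -leqn0 leqNgt.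
by exists i; apply: mnm_pos_split.
Qed.

Lemma mdeg_mnm1D i b : mdeg (mnm1 i +m b) = (mdeg b).+1.
Proof. by rewrite mdegD mdeg1. Qed.

End Multinoms.

Lemma psumr_gt0P (R : realDomainType) (I : finType) (F : I -> R) :
  (forall i, 0 <= F i) -> 0 < \sum_i F i <-> exists i, 0 < F i.
Proof.
move=> F0; split=> [|[i Fi]].
  rewrite lt0r sumr_ge0 // andbT => /negP sn0.
  have : ~~ [forall i, F i == 0].
    by apply/negP => /forallP all0; apply: sn0; rewrite big1 // => i _; apply/eqP.
  by rewrite negb_forall => /existsP[i Fi]; exists i; rewrite lt0r Fi F0.
by rewrite (bigD1 i) //= ltr_pwDl // sumr_ge0.
Qed.

(** * Derivatives as translations, and the local-to-global step *)

(* A homogeneous polynomial is represented by the function c sending m to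
   m! times its coefficient at m, so that the i-th partial derivative becomes
   the translation m |-> c (m + e_i). *)
Section Derivations.
Variables (R : realType) (n : nat).
Implicit Types (c : multinom n -> R) (m b : multinom n).
Implicit Types (u v x y : 'rV[R]_n) (vs ws : seq 'rV[R]_n).

Definition shift_deriv v c : multinom n -> R :=
  fun m => \sum_i v 0 i * c (m +m mnm1 i).

Definition shift_derivs vs c : multinom n -> R := foldr shift_deriv c vs.

Definition hess_form c m x y : R := shift_deriv x (shift_deriv y c) m.

Definition hess_mx c m : 'M[R]_n := \matrix_(i, j) c (m +m mnm1 i +m mnm1 j).

Definition positive_vector v : Prop := forall i, 0 < v 0 i.

Lemma shift_derivC u v c :
  shift_deriv u (shift_deriv v c) = shift_deriv v (shift_deriv u c).
Proof.
apply/funext => m; rewrite /shift_deriv.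
under eq_bigr do rewrite mulr_sumr.
rewrite exchange_big /=; apply: eq_bigr => i _; rewrite mulr_sumr.
by apply: eq_bigr => j _; rewrite mulrCA mnm_addAC.
Qed.

Lemma hess_formE c m x y : hess_form c m x y = bform (hess_mx c m) x y.
Proof.
apply: eq_bigr => i _; rewrite mulr_sumr; apply: eq_bigr => j _.
by rewrite mxE mulrA mulrAC.
Qed.

Lemma hess_formEfun c m : hess_form c m = bform (hess_mx c m).
Proof. by apply/funext => x; apply/funext => y; exact: hess_formE. Qed.

Lemma tr_hess_mx c m : (hess_mx c m)^T = hess_mx c m.
Proof. by apply/matrixP => i j; rewrite !mxE mnm_addAC. Qed.

Lemma shift_derivs_rem v vs c : v \in vs ->
  shift_derivs vs c = shift_deriv v (shift_derivs (rem v vs) c).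
Proof.
elim: vs => //= w vs IH; case: (eqVneq w v) => [-> //|wv].
rewrite inE eq_sym (negPf wv) /= => /IH ->.
by rewrite shift_derivC.
Qed.

Lemma shift_derivs_perm vs ws c :
  perm_eq vs ws -> shift_derivs vs c = shift_derivs ws c.
Proof.
elim: vs ws => [|v vs IH] ws; first by rewrite perm_sym => /perm_nilP ->.
move=> vsws; have vws : v \in ws by rewrite -(perm_mem vsws) mem_head.
rewrite (shift_derivs_rem c vws) /=; congr shift_deriv; apply: IH.
by rewrite -(perm_cons v) (permPl vsws) perm_to_rem.
Qed.

Lemma shift_derivs_ge0 vs c : (forall m, 0 <= c m) ->
  (forall v, v \in vs -> positive_vector v) ->
  forall m, 0 <= shift_derivs vs c m.
Proof.
move=> c0; elim: vs => //= v vs IH vs0 m.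
apply: sumr_ge0 => i _; rewrite mulr_ge0 ?IH //.
  by rewrite ltW // vs0 // mem_head.
by move=> w wvs; apply: vs0; rewrite inE wvs orbT.
Qed.

(** Expanding the derivatives gives a combination of the values [c (m +m b)] with positive weights,
    so no cancellation occurs. *)
Lemma shift_derivs_gt0 vs c m : (forall m, 0 <= c m) ->
  (forall v, v \in vs -> positive_vector v) ->
  0 < shift_derivs vs c m <->
  exists b, mdeg b = size vs /\ 0 < c (m +m b).
Proof.
move=> c0; elim: vs m => [|v vs IH] m vs0 /=.
  split=> [cm|[b [/eqP]]]; first by exists mnm0; rewrite mdeg0 addm0.
  by rewrite mdeg_eq0 => /eqP ->; rewrite addm0.
have v0 : positive_vector v by apply: vs0; rewrite mem_head.
have {}vs0 w : w \in vs -> positive_vector w.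
  by move=> wvs; apply: vs0; rewrite inE wvs orbT.
have ge0 := shift_derivs_ge0 c0 vs0.
rewrite psumr_gt0P => [|i]; last by rewrite mulr_ge0 // ltW.
split=> [[i]|[b [degb cb]]].
  rewrite pmulr_rgt0 // => /IH[//|b [degb cb]].
  by exists (mnm1 i +m b); rewrite mdeg_mnm1D degb addmA.
have [|i [b' eqb]] := @mdeg_gt0_split _ b; first by rewrite degb.
exists i; rewrite pmulr_rgt0 //; apply/IH => //; exists b'.
move: degb cb; rewrite eqb mdeg_mnm1D addmA => -[->].
by [].
Qed.

(** The slices T(.,.,e_i) are the forms at [m +m mnm1 i]. Reverse Cauchy-Schwarz for the pair [v],
    [x] in each slice, summed with weights [v 0 i], is the inequality required by
    [lorentzian_local_to_global]. *)
Lemma lorentzian_hess_trickle c m v : (forall m, 0 <= c m) ->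
  positive_vector v ->
  (forall i, lorentzian_form (hess_form c (m +m mnm1 i))) ->
  connected_matrix (hess_mx (shift_deriv v c) m) ->
  lorentzian_form (hess_form (shift_deriv v c) m).
Proof.
move=> c0 v0 lorc conn; rewrite hess_formEfun.
have vA x i : (x *m hess_mx (shift_deriv v c) m) 0 i =
    hess_form c (m +m mnm1 i) x v.
  rewrite mxE; apply: eq_bigr => j _; rewrite mxE; congr (_ * _).
  by apply: eq_bigr => k _; rewrite (mnm_addAC _ (mnm1 j)).
apply: (lorentzian_local_to_global (v := v)) => //.
- exact: tr_hess_mx.
- by move=> i j; rewrite mxE sumr_ge0 // => k _; rewrite mulr_ge0 // ltW.
move=> x.
have -> : bform (hess_mx (shift_deriv v c) m) x x =
    \sum_i v 0 i * hess_form c (m +m mnm1 i) x x.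
  by rewrite -hess_formE /hess_form -(shift_derivC v) -(shift_derivC v).
apply: ler_sum => i _; rewrite !vA -mulrA ler_pM2l //.
have : 0 <= hess_form c (m +m mnm1 i) v v.
  apply: sumr_ge0 => j _; rewrite mulr_ge0 ?(ltW (v0 j)) //.
  by apply: sumr_ge0 => k _; rewrite mulr_ge0 // ltW.
(* If a slice vanishes at the positive vector [v], all its nonnegative entries are 0 and both sides
   are 0. *)
rewrite le_eqVlt => /orP[/eqP Qv|Qv].
  have hess0 j k : c (m +m mnm1 i +m mnm1 j +m mnm1 k) = 0.
    apply/eqP; rewrite eq_le c0 andbT leNgt; apply/negP => cpos.
    suff : 0 < hess_form c (m +m mnm1 i) v v by rewrite -Qv ltxx.
    apply/(@shift_derivs_gt0 [:: v; v]) => //.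
      by move=> w; rewrite !inE orbb => /eqP ->.
    exists (mnm1 j +m mnm1 k); split; first by rewrite mdegD !mdeg1.
    by rewrite addmA.
  rewrite -Qv invr0 mul0r hess_formE /bform big1 // => j _.
  by rewrite big1 // => k _; rewrite mxE hess0 mulr0 mul0r.
rewrite ler_pdivlMl // (_ : hess_form c _ x v = hess_form c (m +m mnm1 i) v x).
  exact: lorc.
by rewrite /hess_form shift_derivC.
Qed.

(** Induction on [vs]: each direction costs one use of [lorentzian_hess_trickle], whose slices trade
    a direction for a unit of [m], so the total [e] is preserved. *)
Lemma lorentzian_hess_positive c e : (forall m, 0 <= c m) ->
  (forall m, mdeg m = e -> lorentzian_form (hess_form c m)) ->
  (forall vs m, (forall v, v \in vs -> positive_vector v) ->
    (0 < size vs)%N -> (mdeg m + size vs)%N = e ->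
    connected_matrix (hess_mx (shift_derivs vs c) m)) ->
  forall vs m, (forall v, v \in vs -> positive_vector v) ->
    (mdeg m + size vs)%N = e ->
    lorentzian_form (hess_form (shift_derivs vs c) m).
Proof.
move=> c0 lorc conn; elim=> [|v vs IH] m vs0 /= degm.
  by apply: lorc; rewrite -degm addn0.
apply: lorentzian_hess_trickle.
- apply: shift_derivs_ge0 => // w wvs; apply: vs0; rewrite inE wvs orbT //.
- by apply: vs0; rewrite mem_head.
- move=> i; apply: IH => [w wvs|]; first by apply: vs0; rewrite inE wvs orbT.
  by rewrite mdegD mdeg1 -addnA add1n.
- exact: (conn (v :: vs)).
Qed.

(** Reverse Cauchy-Schwarz is tested on the indicators of [S] and of its complement: internal edges
    make both squares positive, which forces a positive cross term. *)
Lemma lorentzian_connected (A : 'M[R]_n) : A^T = A -> (forall i j, 0 <= A i j) ->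
  lorentzian_form (bform A) -> connected_matrix A.
Proof.
move=> symA A0 lorA S [i [i' [Si Si' Aii']]] [j [j' [Sj Sj' Ajj']]].
pose ind (T : pred 'I_n) : 'rV[R]_n := \row_k (T k)%:R.
have ind_gt0 T T' : 0 < bform A (ind T) (ind T') <->
    exists k l, [/\ T k, T' l & 0 < A k l].
  have term_ge0 k l : 0 <= ind T 0 k * A k l * ind T' 0 l.
    by rewrite !mxE !mulr_ge0.
  rewrite psumr_gt0P => [|k]; last exact: sumr_ge0.
  split=> [[k]|[k [l [Tk Tl Akl]]]].
    rewrite psumr_gt0P // => -[l]; rewrite !mxE => gt0; exists k, l.
    move: gt0; case: (T k); case: (T' l);
      by rewrite ?(mulr0, mul0r, mul1r, mulr1, ltxx).
  exists k; apply/psumr_gt0P => //; exists l.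
  by rewrite !mxE Tk Tl mul1r mulr1.
have QS : 0 < bform A (ind S) (ind S) by apply/ind_gt0; exists i, i'.
have QS' : 0 < bform A (ind (predC S)) (ind (predC S)).
  by apply/ind_gt0; exists j, j'.
have := lorA _ (ind (predC S)) QS.
move=> /(lt_le_trans (mulr_gt0 QS QS')).
have B0 : 0 <= bform A (ind S) (ind (predC S)).
  by apply: sumr_ge0 => k _; apply: sumr_ge0 => l _; rewrite !mxE !mulr_ge0.
rewrite exprn_even_gt0 //= => Bn0.
by apply/ind_gt0; rewrite lt0r Bn0.
Qed.

End Derivations.

(** * Connectedness of sets of exponents and of matrices *)

Section Connectivity.
Variables (R : realType) (n : nat).
Implicit Types (m a b : multinom n) (M T : set (multinom n)).

Lemma set_derivE b M a : set_deriv b M a <-> M (b +m a).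
Proof.
split=> [[a' [Ma' ba'] <-]|Ma]; first by rewrite addmC submK.
exists (b +m a); first by split=> //; apply: lem_addr.
by rewrite addmC addmK.
Qed.

Lemma tauE M a : tau M a <-> exists i, M (mnm1 i +m a).
Proof.
split=> [[i _ /set_derivE Mia]|[i Mia]]; first by exists i.
by exists i => //; apply/set_derivE.
Qed.

(** Two distinct indices in the support of one element of [T] span an edge, and each element carries
    an edge or a loop. Hence a cut without crossing edges is the same as a partition of [T] by
    support. *)
Lemma set_connected_matrix T r (A : 'M[R]_n) : constant_sum r T -> (2 <= r)%N ->
  (forall i j, 0 < A i j <-> exists b, T (mnm1 i +m mnm1 j +m b)) ->
  set_connected T <-> connected_matrix A.
Proof.
move=> sumT r2 A_gt0.
have mem2 a i j : T a -> (0 < a i)%N -> (0 < a j)%N -> i != j -> 0 < A i j.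
  move=> Ta /mnm_pos_split[b eqa] aj ij; apply/A_gt0.
  have [|b' eqb] := @mnm_pos_split _ b j.
    by move: aj; rewrite eqa mnmDE mnm1E (negPf ij).
  by exists b'; rewrite -addmA -eqb -eqa.
have ex2 a : T a -> exists i j b, a = mnm1 i +m mnm1 j +m b.
  move=> /sumT dega; have [|i [b eqa]] := @mdeg_gt0_split _ a.
    by rewrite dega (leq_trans _ r2).
  have [|j [b' eqb]] := @mdeg_gt0_split _ b.
    by move: dega; rewrite eqa mdeg_mnm1D => degb; rewrite -ltnS degb.
  by exists i, j, b'; rewrite eqa eqb addmA.
have in2l i j b : (0 < (mnm1 i +m mnm1 j +m b) i)%N.
  by rewrite !mnmDE mnm1E eqxx.
have in2r i j b : (0 < (mnm1 i +m mnm1 j +m b) j)%N.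
  by rewrite !mnmDE mnm1E [mnm1 j j]mnm1E eqxx addn1.
split=> [[r' [sumT' conT]] S [i [i' [Si Si' /A_gt0[b Tb]]]]
    [j [j' [Sj Sj' /A_gt0[b' Tb']]]]|conA].
  (* The sum [r'] chosen in [set_connected] agrees with [r] because [T] is nonempty here. *)
  have r'2 : (2 <= r')%N by rewrite -(sumT' _ Tb) (sumT _ Tb).
  apply: contrapT => noX; apply: conT => //.
  have mono a : T a ->
      (forall k, S k -> a k = 0%N) \/ (forall k, ~~ S k -> a k = 0%N).
    move=> Ta; case: (pselect (exists k, S k /\ (0 < a k)%N)) => [[k [Sk ak]]|nk].
      right=> l Sl; apply/eqP; rewrite -leqn0 leqNgt; apply/negP => al.
      apply: noX; exists k, l; split=> //; apply: (mem2 a) => //.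
      by apply: contraNneq Sl => <-.
    left=> k Sk; apply/eqP; rewrite -leqn0 leqNgt; apply/negP => ak.
    by apply: nk; exists k.
  exists [set k | S k]; split.
  - by split=> // /(_ j I) /=; apply/negP.
  - exists (mnm1 j +m mnm1 j' +m b'); split=> // k Sk.
    case: (mono _ Tb') => [/(_ k Sk)//|/(_ j Sj) j0].
    by have := in2l j j' b'; rewrite j0.
  - exists (mnm1 i +m mnm1 i' +m b); split=> // k /negP Sk.
    case: (mono _ Tb) => [/(_ i Si) i0|/(_ k Sk)//].
    by have := in2l i i' b; rewrite i0.
  - rewrite -subset0 => a [[Ta aS] [_ aS']].
    have [k [l [e eqa]]] := ex2 a Ta; have := in2l k l e; rewrite -eqa.
    by case: (pselect (S k)) => Sk; [rewrite (aS k Sk)|rewrite (aS' k Sk)].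
  - apply/seteqP; split=> [a [[]//|[]//]|a Ta].
    case: (mono a Ta) => aS; [left|right]; split=> // k /negP; exact: aS.
exists r; split=> // _ [S [_ [a [Ta aS]] [a' [Ta' aS']] _ SUS']].
have [i [i' [b eqa]]] := ex2 a Ta; have [j [j' [b' eqa']]] := ex2 a' Ta'.
have notS k : (0 < a k)%N -> ~ S k by move=> ak /aS a0; rewrite a0 in ak.
have inS k : (0 < a' k)%N -> S k.
  by move=> ak; apply: contrapT => /aS' a0; rewrite a0 in ak.
have [||k [l [/asboolP Sk /asboolPn Sl /A_gt0[e Te]]]] :=
    conA (fun k => `[< S k >]).
- exists j, j'; split; [apply/asboolP..|].
  + by apply: inS; rewrite eqa'.
  + by apply: inS; rewrite eqa'.
  + by apply/A_gt0; exists b'; rewrite -eqa'.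
- exists i, i'; split; [apply/asboolPn..|].
  + by apply: notS; rewrite eqa.
  + by apply: notS; rewrite eqa.
  + by apply/A_gt0; exists b; rewrite -eqa.
have : (vanishing_on S T `|` vanishing_on (~` S) T) (mnm1 k +m mnm1 l +m e).
  by rewrite SUS'.
by case=> -[_ v0]; [have := in2l k l e|have := in2r k l e]; rewrite v0.
Qed.

Lemma set_connected_hess (c : multinom n -> R) d (M : set (multinom n))
    (vs : seq 'rV[R]_n) m :
  (forall a, 0 <= c a) -> (forall a, M a <-> mdeg a = d /\ 0 < c a) ->
  (forall v, v \in vs -> positive_vector v) -> (0 < size vs)%N ->
  (mdeg m + size vs + 2)%N = d ->
  set_connected (set_deriv m (tau M)) <->
  connected_matrix (hess_mx (shift_derivs vs c) m).
Proof.
move=> c0 Mc vs0 vs_gt0 degm.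
(* The constant sum is d - 1 - |m|. As [vs] is nonempty, an exponent of degree [size vs] has a unit
   to spare, which [tau] removes. *)
apply: (@set_connected_matrix _ (size vs).+1) => // [a|i j].
  move=> /set_derivE/tauE[i /Mc[]]; rewrite mdeg_mnm1D mdegD -degm.
  by move=> /eqP; rewrite -addnS -addnA eqn_add2l addn2 eqSS => /eqP.
rewrite mxE shift_derivs_gt0 //; split=> [[b [degb cb]]|[b]].
  have [|k [b' eqb]] := @mdeg_gt0_split _ b; first by rewrite degb.
  exists b'; apply/set_derivE/tauE; exists k.
  have -> : mnm1 k +m (m +m (mnm1 i +m mnm1 j +m b')) =
      m +m mnm1 i +m mnm1 j +m b.
    by apply/mnmP => l; rewrite eqb !mnmDE; lia.
  by apply/Mc; split=> //; rewrite !mdegD !mdeg1 degb -degm; lia.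
move=> /set_derivE/tauE[k /Mc[degkb ckb]]; exists (mnm1 k +m b); split.
  by move: degkb; rewrite !mdegD !mdeg1 -degm; lia.
congr (0 < c _): ckb; apply/mnmP => l; rewrite !mnmDE; lia.
Qed.

End Connectivity.

(** * Translation between polynomials and normalized coefficients *)

Section NormalizedCoefficients.
Variables (R : realType) (n : nat).
Implicit Types (f g : mpoly n R) (m a b : multinom n) (s : seq 'I_n).

Definition mnm_fact m : nat := (\prod_i (m i)`!)%N.

Definition nmcoeff f m : R := mcoeff m f *+ mnm_fact m.

Lemma mnm_fact_gt0 m : (0 < mnm_fact m)%N.
Proof. by apply: prodn_gt0 => i; exact: fact_gt0. Qed.

Lemma nmcoeff_eq0 f m : (nmcoeff f m == 0) = (mcoeff m f == 0).
Proof. by rewrite /nmcoeff mulrn_eq0 gtn_eqF ?mnm_fact_gt0. Qed.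

Lemma nmcoeff_ge0 f m : (0 <= nmcoeff f m) = (0 <= mcoeff m f).
Proof. by rewrite /nmcoeff pmulrn_lge0 ?mnm_fact_gt0. Qed.

Lemma nmcoeff0 f : nmcoeff f (@mnm0 n) = mcoeff (@mnm0 n) f.
Proof. by rewrite /nmcoeff /mnm_fact big1 // => i _; rewrite mnm0E. Qed.

Lemma nmcoeff_deriv i f m : nmcoeff (mderiv i f) m = nmcoeff f (m +m mnm1 i).
Proof.
rewrite /nmcoeff mcoeff_deriv -mulrnA; congr (_ *+ _).
rewrite /mnm_fact (bigD1 i) //= [RHS](bigD1 i) //= mnmDE mnm1E eqxx addn1.
rewrite factS mulnA; congr (_ * _)%N; apply: eq_bigr => j ji.
by rewrite mnmDE mnm1E eq_sym (negPf ji) addn0.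
Qed.

Lemma s2m_cons i s : s2m (i :: s) = mnm1 i +m s2m s.
Proof. by apply/mnmP => j; rewrite mnmDE mnm1E !mnmE. Qed.

Lemma s2m_nil : s2m [::] = @mnm0 n.
Proof. by apply/mnmP => j; rewrite !mnmE. Qed.

Lemma mdeg_s2m s : mdeg (s2m s) = size s.
Proof.
by elim: s => [|i s IH]; rewrite ?s2m_nil ?mdeg0 // s2m_cons mdeg_mnm1D IH.
Qed.

Lemma nmcoeff_pderivs s f m : nmcoeff (pderivs s f) m = nmcoeff f (m +m s2m s).
Proof.
elim: s m => [|i s IH] m /=; first by rewrite s2m_nil addm0.
by rewrite nmcoeff_deriv IH s2m_cons addmA.
Qed.

Lemma mcoeff0_pderivs s f :
  mcoeff (@mnm0 n) (pderivs s f) = nmcoeff f (s2m s).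
Proof. by rewrite -nmcoeff0 nmcoeff_pderivs add0m. Qed.

Lemma nmcoeff_dirderiv u f :
  nmcoeff (dirderiv u f) = shift_deriv u (nmcoeff f).
Proof.
apply/funext => m; rewrite /nmcoeff /dirderiv raddf_sum /= -sumrMnl.
apply: eq_bigr => i _; rewrite mcoeffZ -mulrnAr; congr (_ * _).
exact: nmcoeff_deriv.
Qed.

Lemma shift_deriv_delta i (c : multinom n -> R) m :
  shift_deriv (delta_mx 0 i) c m = c (m +m mnm1 i).
Proof.
rewrite /shift_deriv (bigD1 i) //= big1 ?addr0 => [|j ji].
  by rewrite mxE !eqxx mul1r.
by rewrite mxE (negPf ji) mul0r.
Qed.

Lemma second_form_mxE s f :
  second_form_mx (pderivs s f) = hess_mx (nmcoeff f) (s2m s).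
Proof.
apply/matrixP => i j; rewrite [LHS]mxE /second_form -nmcoeff0.
rewrite !nmcoeff_dirderiv !shift_deriv_delta nmcoeff_pderivs mxE.
congr nmcoeff.
by apply/mnmP => k; rewrite !mnmDE mnm0E; lia.
Qed.

Lemma homogeneous_nmcoeff d f m : homogeneous d f -> mdeg m != d ->
  nmcoeff f m = 0.
Proof.
by move=> homf degm; apply/eqP; rewrite nmcoeff_eq0 (dhomog_nemf_coeff homf).
Qed.

(** By homogeneity, [mderivm a f] is the constant [nmcoeff f a] when [a] has degree [d]. *)
Lemma supp_nmcoeff d f a : homogeneous d f -> (forall m, 0 <= mcoeff m f) ->
  supp d f a <-> mdeg a = d /\ 0 < nmcoeff f a.
Proof.
move=> homf f0.
have cE m : nmcoeff (mderivm a f) m = nmcoeff f (m +m a).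
  by rewrite mderivm_foldr nmcoeff_pderivs s2mK.
split=> -[degm]; last first.
  move=> fa; split=> // fa0; move: fa; rewrite -[a]add0m -cE fa0.
  by rewrite /nmcoeff mcoeff0 mul0rn ltxx.
move=> fa; split=> //; rewrite lt0r nmcoeff_ge0 f0 andbT.
apply/eqP => fa0; apply: fa; apply/mpolyP => m; rewrite mcoeff0.
apply/eqP; rewrite -nmcoeff_eq0 cE; have [->|m0] := eqVneq m (@mnm0 n).
  by rewrite add0m fa0.
rewrite (homogeneous_nmcoeff homf) // mdegD degm -[X in _ != X]add0n.
by rewrite eqn_add2r mdeg_eq0.
Qed.

(** A section of [nmcoeff] in degree [d]; the bounded exponents [bmultinom n d.+1] form a finite
    index type. *)
Definition mpoly_of d (c : multinom n -> R) : mpoly n R :=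
  \sum_(m : bmultinom n d.+1 | mdeg m == d)
     (c m / (mnm_fact m)%:R) *: mpolyX R m.

Lemma homogeneous_mpoly_of d c : homogeneous d (mpoly_of d c).
Proof.
by apply: rpred_sum => m degm; apply: dhomogZ; rewrite dhomogX.
Qed.

Lemma nmcoeff_mpoly_of d c m : mdeg m = d -> nmcoeff (mpoly_of d c) m = c m.
Proof.
move=> degm; have ltm : (mdeg m < d.+1)%N by rewrite degm.
rewrite /nmcoeff /mpoly_of raddf_sum /= (bigD1 (BMultinom ltm)) /=; last first.
  by rewrite degm.
rewrite big1 ?addr0 => [|b /andP[_ bm]]; last first.
  rewrite mcoeffZ mcoeffX; case: eqP => [eqb|]; rewrite ?mulr0 //.
  by case/eqP: bm; apply: val_inj.
rewrite mcoeffZ mcoeffX eqxx mulr1 -[LHS]mulr_natr divfK //.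
by rewrite pnatr_eq0 gtn_eqF ?mnm_fact_gt0.
Qed.

End NormalizedCoefficients.

(** * Passage to the limit *)

Section Limits.
Variables (R : realType) (n : nat).
Implicit Types (c : multinom n -> R) (m : multinom n).

Lemma cvg_shift_deriv (vk : nat -> 'rV[R]_n) (v : 'rV[R]_n)
    (ck : nat -> multinom n -> R) c m :
  (forall i, vk k 0 i @[k --> \oo] --> v 0 i) ->
  (forall m, ck k m @[k --> \oo] --> c m) ->
  shift_deriv (vk k) (ck k) m @[k --> \oo] --> shift_deriv v c m.
Proof.
move=> cvgv cvgc; apply: (@cvg_big R^o _ _ _ _ (@add_continuous R^o)) => i _.
apply: cvgM; first exact: cvgv.
exact: cvgc.
Qed.

Lemma cvg_shift_derivs (vs : seq 'rV[R]_n) (ck : nat -> multinom n -> R) c m :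
  (forall m, ck k m @[k --> \oo] --> c m) ->
  shift_derivs vs (ck k) m @[k --> \oo] --> shift_derivs vs c m.
Proof.
move=> cvgc; elim: vs m => [|v vs IH] m; first exact: cvgc.
by apply: (@cvg_shift_deriv (fun=> v)) => // i; exact: cvg_cst.
Qed.

Lemma lorentzian_form_lim (Bk : nat -> 'rV[R]_n -> 'rV[R]_n -> R) B :
  (forall k, lorentzian_form (Bk k)) ->
  (forall x y, Bk k x y @[k --> \oo] --> B x y) -> lorentzian_form B.
Proof.
move=> lorB cvgBk x y Bxx.
have cvgD : Bk k x y ^+ 2 - Bk k x x * Bk k y y @[k --> \oo] -->
    B x y ^+ 2 - B x x * B y y.
  by under eq_cvg do rewrite expr2; rewrite expr2; apply: cvgB;
    [apply: cvgM|apply: cvgM]; exact: cvgBk.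
rewrite -subr_ge0 -(cvg_lim (@Rhausdorff R) cvgD).
apply: limr_ge; first by apply/cvg_ex; eexists; exact: cvgD.
(* The premise [0 < B x x] is an open condition, so it holds eventually along the sequence. *)
apply: filterS (cvgr_gt _ (cvgBk x x) _ Bxx) => k Bkxx.
by rewrite subr_ge0; exact: lorB.
Qed.

End Limits.

(** * Lorentzian polynomials satisfy both conditions *)

Section Necessity.
Variables (R : realType) (n d : nat).
Implicit Types (f : mpoly n R) (m : multinom n).

Lemma lorentzian_hess_strict f vs m : strictly_lorentzian d f -> (2 <= d)%N ->
  (forall v, v \in vs -> positive_vector v) -> (mdeg m + size vs + 2)%N = d ->
  lorentzian_form (hess_form (shift_derivs vs (nmcoeff f)) m).
Proof.
move=> [homf posf hessf] d2 vs0 degm.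
have c_gt0 a : mdeg a = d -> 0 < nmcoeff f a.
  move=> dega; have /eqP sza : size (m2s a) = d by rewrite size_m2s.
  by have := posf (Tuple sza); rewrite mcoeff0_pderivs s2mK.
have c_ge0 a : 0 <= nmcoeff f a.
  have [/eqP/c_gt0/ltW//|dega] := boolP (mdeg a == d).
  by rewrite (homogeneous_nmcoeff homf).
apply: (@lorentzian_hess_positive _ _ _ (d - 2)) => //; last by rewrite -degm addnK.
- move=> a dega; have /eqP sza : size (m2s a) = (d - 2)%N by rewrite size_m2s.
  have [_] := hessf d2 (Tuple sza); rewrite second_form_mxE s2mK => num1.
  rewrite hess_formEfun; apply/num_pos_le1P; first exact: tr_hess_mx.
  by rewrite num1.
move=> ws a ws0 sz dega S [i [_ [Si _ _]]] [j [_ [Sj _ _]]].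
exists i, j; split=> //; rewrite mxE; apply/shift_derivs_gt0 => //.
(* All coefficients of degree [d] are positive, so any exponent of the right degree serves. *)
exists (s2m (nseq (size ws) i)); rewrite mdeg_s2m size_nseq; split=> //.
by apply: c_gt0; rewrite !mdegD !mdeg1 mdeg_s2m size_nseq; lia.
Qed.

Lemma lorentzian_hess_lim f vs m : lorentzian d f -> (2 <= d)%N ->
  (forall v, v \in vs -> positive_vector v) -> (mdeg m + size vs + 2)%N = d ->
  lorentzian_form (hess_form (shift_derivs vs (nmcoeff f)) m).
Proof.
move=> [_ [F [strF cvgF]]] d2 vs0 degm.
apply: (@lorentzian_form_lim _ _
  (fun k => hess_form (shift_derivs vs (nmcoeff (F k))) m)) => [k|x y].
  exact: lorentzian_hess_strict (strF k) d2 vs0 degm.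
(* The value of the form is itself an iterated derivative, with [x] and [y] as two more
   directions. *)
apply: (@cvg_shift_derivs _ _ [:: x, y & vs]) => a.
rewrite /nmcoeff -mulr_natr; under eq_fun do rewrite -mulr_natr.
by apply: cvgM; [exact: cvgF|exact: cvg_cst].
Qed.

Lemma lorentzian_H_connected f : lorentzian d f -> (2 <= d)%N ->
  (forall m, 0 <= mcoeff m f) -> H_connected (tau (supp d f)).
Proof.
move=> lorf d2 f0; have homf := lorf.1.
have suppE a := supp_nmcoeff a homf f0.
have c0 a : 0 <= nmcoeff f a by rewrite nmcoeff_ge0.
exists d.-1; split=> [a /tauE[i /suppE[]]|d3 a dega].
  by rewrite mdeg_mnm1D => <-.
(* Any positive directions would do; the bound on [mdeg a] leaves at least one. *)
pose vs : seq 'rV[R]_n := nseq (d - 2 - mdeg a) (const_mx 1).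
have vs0 v : v \in vs -> positive_vector v.
  by move=> /nseqP[-> _] i; rewrite mxE.
have sz : (mdeg a + size vs + 2)%N = d by rewrite size_nseq; lia.
apply/(set_connected_hess c0 suppE vs0 _ sz); first by rewrite size_nseq; lia.
apply: lorentzian_connected; first exact: tr_hess_mx.
  by move=> i j; rewrite mxE shift_derivs_ge0.
by rewrite -hess_formEfun; exact: lorentzian_hess_lim.
Qed.

Lemma lorentzian_num_pos f (i : (d - 2).-tuple 'I_n) : lorentzian d f ->
  (2 <= d)%N -> (num_pos_eigenvalues (second_form_mx (pderivs i f)) <= 1)%N.
Proof.
move=> lorf d2; rewrite second_form_mxE; apply/num_pos_le1P.
  exact: tr_hess_mx.
rewrite -hess_formEfun; apply: (@lorentzian_hess_lim f [::]) => //.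
by rewrite addn0 mdeg_s2m size_tuple subnK.
Qed.

End Necessity.

(** * Making a form non-singular by a small positive definite correction *)

Section Perturbation.
Variables (R : realType) (n : nat).
Implicit Types (A P : 'M[R]_n) (x y p : 'rV[R]_n).

Lemma bformB A P (e : R) x y :
  bform (A - e *: P) x y = bform A x y - e * bform P x y.
Proof.
rewrite /bform mulr_sumr -sumrB; apply: eq_bigr => i _.
rewrite mulr_sumr -sumrB; apply: eq_bigr => j _.
by rewrite !mxE; ring.
Qed.

Lemma bform_mulmx A x y : bform A x y = dot y (x *m A).
Proof.
rewrite /bform exchange_big; apply: eq_bigr => j _.
by rewrite mxE -mulr_suml mulrC.
Qed.

Lemma lorentzian_form_hyperplane A : lorentzian_form (bform A) ->
  exists p, forall y, dot y p = 0 -> bform A y y <= 0.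
Proof.
move=> lorA; have [[x Qx]|nQ] := pselect (exists x, 0 < bform A x x).
  exists (x *m A) => y; rewrite -bform_mulmx => xy.
  by have := lorA x y Qx; rewrite xy expr0n /= pmulr_rle0.
exists 0 => y _; rewrite leNgt; apply/negP => Qy; apply: nQ.
by exists y.
Qed.

Lemma posdef_unitmx P : (forall x, x != 0 -> 0 < bform P x x) -> P \in unitmx.
Proof.
move=> posP; rewrite -row_free_unit -kermx_eq0; apply/rowV0P => x.
move=> /sub_kermxP xP; apply/eqP; apply: contraT => /posP.
by rewrite bform_mulmx xP /dot big1 ?ltxx // => i _; rewrite mxE mulr0.
Qed.

Lemma near_nonroot (q : {poly R}) : q != 0 ->
  \forall e \near 0^'+, ~~ root q e.
Proof.
move=> q0; set r := rootsR q.
have : \forall e \near (0 : R)^'+, forall i : 'I_(size r), e != r`_i.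
  apply: filter_forall => i; have [ri|ri] := ltP 0 r`_i.
    by apply: filterS (nbhs_right_lt ri) => e; rewrite neq_lt => ->.
  apply: filterS (nbhs_right_gt 0) => e /(le_lt_trans ri).
  by rewrite neq_lt orbC => ->.
apply: filterS => e er; apply/negP => qe.
have : e \in r by rewrite -(roots_on_rootsR q0) inE.
move=> e_r; have lt_e : (index e r < size r)%N by rewrite index_mem.
by have := er (Ordinal lt_e); rewrite /= nth_index // eqxx.
Qed.

(** Subtracting [e *: P] keeps the form nonpositive on a hyperplane and, for small [e], positive at
    [x]. It is singular only when [e] is an eigenvalue of [invmx P *m A], which excludes finitely
    many values. *)
Lemma near_perturb_lorentzian A P x : A^T = A -> P^T = P ->
  (forall x, x != 0 -> 0 < bform P x x) ->
  lorentzian_form (bform A) -> 0 < bform A x x ->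
  \forall e \near 0^'+, A - e *: P \in unitmx /\
    num_pos_eigenvalues (A - e *: P) = 1%N.
Proof.
move=> symA symP posP lorA Qx.
have P_ge0 y : 0 <= bform P y y.
  have [->|/posP/ltW//] := eqVneq y 0.
  by rewrite /bform big1 // => i _; rewrite big1 // => j _; rewrite mxE !mul0r.
have x0 : x != 0.
  apply: contraTneq Qx => ->; rewrite -leNgt /bform big1 // => i _.
  by rewrite big1 // => j _; rewrite mxE !mul0r.
have unitP := posdef_unitmx posP.
have [p negA] := lorentzian_form_hyperplane lorA.
near=> e.
have e0 : 0 < e by near: e; exact: nbhs_right_gt.
have ex : e < bform A x x / bform P x x.
  by near: e; apply: nbhs_right_lt; rewrite divr_gt0 // posP.
have e_nroot : ~~ root (char_poly (invmx P *m A)) e.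
  by near: e; apply: near_nonroot; rewrite monic_neq0 // char_poly_monic.
have symAP : (A - e *: P)^T = A - e *: P.
  by rewrite linearB /= linearZ /= symA symP.
split.
  have -> : A - e *: P = P *m (invmx P *m A - e%:M).
    by rewrite mulmxBr mulmxA mulmxV // mul1mx mul_mx_scalar.
  rewrite unitmx_mul unitP /= -row_free_unit -kermx_eq0.
  by move: e_nroot; rewrite -eigenvalue_root_char /eigenvalue negbK.
apply/eqP; rewrite eqn_leq; apply/andP; split.
  apply/num_pos_le1P => //; apply: (@lorentzian_hyperplane _ _ _ p) => // y yp.
  by rewrite bformB subr_le0 (le_trans (negA y yp)) // mulr_ge0 // ltW.
apply: (@num_pos_gt0 _ _ _ x) => //.
by rewrite bformB subr_gt0 -ltr_pdivlMr // posP.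
Unshelve. all: by end_near. Qed.

End Perturbation.

(** * Linear changes of variables *)

Section Polarization.
Variables (R : realType) (n : nat).
Implicit Types (c : multinom n -> R) (m : multinom n) (v x y : 'rV[R]_n).

Lemma perm_m2sD m i : perm_eq (m2s (m +m mnm1 i)) (i :: m2s m).
Proof.
apply/allP => j _ /=; apply/eqP.
have cnt a : count_mem j (m2s a) = a j by rewrite -{2}(s2mK a) mnmE.
by rewrite !cnt mnmDE mnm1E addnC.
Qed.

(* The normalized coefficients of the composition of the polynomial of c with
   the linear map sending the i-th basis vector to a i. *)
Definition linear_subst (a : 'I_n -> 'rV[R]_n) c m : R :=
  shift_derivs [seq a i | i <- m2s m] c (@mnm0 n).

Lemma linear_substD a c m i : linear_subst a c (m +m mnm1 i) =
  shift_deriv (a i) (shift_derivs [seq a j | j <- m2s m] c) (@mnm0 n).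
Proof.
by rewrite /linear_subst (shift_derivs_perm _ (perm_map a (perm_m2sD m i))).
Qed.

Lemma shift_deriv_sum x (a : 'I_n -> 'rV[R]_n) c m :
  shift_deriv (\sum_i x 0 i *: a i) c m =
  \sum_i x 0 i * shift_deriv (a i) c m.
Proof.
rewrite /shift_deriv; under [RHS]eq_bigr do rewrite mulr_sumr.
rewrite exchange_big /=; apply: eq_bigr => j _.
rewrite summxE mulr_suml; apply: eq_bigr => i _.
by rewrite mxE mulrA.
Qed.

(** This is the chain rule; it reduces forms of the substituted polynomial to forms of directional
    derivatives of the original at exponent 0. *)
Lemma hess_form_linear_subst a c m x y :
  hess_form (linear_subst a c) m x y =
  hess_form (shift_derivs [seq a i | i <- m2s m] c) (@mnm0 n)
    (\sum_i x 0 i *: a i) (\sum_i y 0 i *: a i).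
Proof.
have substE v b : shift_deriv v (linear_subst a c) b = shift_deriv
    (\sum_i v 0 i *: a i) (shift_derivs [seq a i | i <- m2s b] c) (@mnm0 n).
  by rewrite shift_deriv_sum; apply: eq_bigr => i _; rewrite linear_substD.
rewrite /hess_form shift_deriv_sum; apply: eq_bigr => i _; congr (_ * _).
rewrite substE (shift_derivs_perm _ (perm_map a (perm_m2sD m i))) /=.
by rewrite shift_derivC.
Qed.

Lemma cvg_linear_subst (a : nat -> 'I_n -> 'rV[R]_n) c m :
  (forall i j, a k i 0 j @[k --> \oo] --> (delta_mx 0 i : 'rV[R]_n) 0 j) ->
  linear_subst (a k) c m @[k --> \oo] --> c m.
Proof.
(* The base exponent 0 is generalized so that the induction on the list can shift it. *)
move=> cvga; rewrite -[m in X in _ --> X]s2mK -[s2m _]add0m /linear_subst.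
elim: (m2s m) (@mnm0 n) => [|i s IH] b /=.
  by rewrite s2m_nil addm0; exact: cvg_cst.
rewrite s2m_cons addmA -(shift_deriv_delta i (fun b => c (b +m s2m s))).
by apply: cvg_shift_deriv => // j; exact: IH.
Qed.

End Polarization.

(** * Approximation by strictly Lorentzian polynomials *)

Section Sufficiency.
Variables (R : realType) (n : nat) (n_gt0 : (0 < n)%N).
Implicit Types (c : multinom n -> R) (m : multinom n) (x y : 'rV[R]_n).

(* The normalized coefficients of \sum_l w_l ^ d / d! for the linear forms
   w_l = t_1 + ... + t_n + t_l: since these span, every second order form is
   positive definite. *)
Definition monomial_value (w : 'I_n -> R) m : R := \prod_i w i ^+ m i.

Definition power_sum m : R :=
  \sum_(l < n) monomial_value (fun i => 1 + (l == i)%:R) m.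

Lemma monomial_valueD (w : 'I_n -> R) m i :
  monomial_value w (m +m mnm1 i) = w i * monomial_value w m.
Proof.
rewrite /monomial_value (bigD1 i) //= [in RHS](bigD1 i) //= mulrA.
rewrite mnmDE mnm1E eqxx addn1 exprS; congr (_ * _); apply: eq_bigr => j ji.
by rewrite mnmDE mnm1E eq_sym (negPf ji) addn0.
Qed.

Lemma weight_gt0 (l i : 'I_n) : 0 < 1 + (l == i)%:R :> R.
Proof. by rewrite ltr_pwDl. Qed.

Lemma monomial_value_gt0 l m :
  0 < monomial_value (fun i => 1 + (l == i)%:R) m.
Proof. by apply: prodr_gt0 => i _; rewrite exprn_gt0 // weight_gt0. Qed.

Lemma power_sum_gt0 m : 0 < power_sum m.
Proof.
apply/psumr_gt0P => [l|]; first exact/ltW/monomial_value_gt0.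
by exists (Ordinal n_gt0); exact: monomial_value_gt0.
Qed.

Lemma bform_power_sum m x : bform (hess_mx power_sum m) x x =
  \sum_(l < n) (\sum_i (1 + (l == i)%:R) * x 0 i) ^+ 2 *
    monomial_value (fun i => 1 + (l == i)%:R) m.
Proof.
rewrite /bform.
under eq_bigr do under eq_bigr do rewrite mxE /power_sum mulr_sumr mulr_suml.
under eq_bigr do rewrite exchange_big /=.
rewrite exchange_big /=; apply: eq_bigr => l _.
rewrite expr2 mulr_suml mulr_suml; apply: eq_bigr => i _.
rewrite mulr_sumr mulr_suml; apply: eq_bigr => j _.
by rewrite !monomial_valueD; ring.
Qed.

(** If every linear form vanishes at [x], then each [x 0 l] is minus the sum of the coordinates;
    summing over [l] shows that n + 1 times this sum is 0. *)
Lemma power_sum_posdef m x : x != 0 -> 0 < bform (hess_mx power_sum m) x x.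
Proof.
move=> x0; rewrite bform_power_sum psumr_gt0P => [|l]; last first.
  by rewrite mulr_ge0 ?sqr_ge0 // ltW // monomial_value_gt0.
suff [l wl] : exists l : 'I_n, \sum_i (1 + (l == i)%:R) * x 0 i != 0.
  by exists l; rewrite mulr_gt0 ?monomial_value_gt0 // exprn_even_gt0.
apply/existsP; apply: contraNT x0; rewrite negb_exists => /forallP w0.
have sumE l : \sum_i (1 + (l == i)%:R) * x 0 i = \sum_i x 0 i + x 0 l.
  under eq_bigr do rewrite mulrDl mul1r.
  rewrite big_split /= [X in _ + X](bigD1 l) //= eqxx mul1r.
  rewrite [X in _ + (_ + X)]big1 ?addr0 // => i il.
  by rewrite eq_sym (negPf il) mul0r.
set sx := \sum_i x 0 i in sumE.
have xE l : x 0 l = - sx.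
  by apply/eqP; rewrite -addr_eq0 addrC -sumE; have := w0 l; rewrite negbK.
have sx0 : sx = 0.
  have : sx *+ n.+1 = 0.
    rewrite mulrS {1}/sx; under eq_bigr do rewrite xE.
    by rewrite sumr_const card_ord mulNrn addNr.
  by move=> /eqP; rewrite mulrn_eq0 /= => /eqP.
by apply/eqP/rowP => l; rewrite xE sx0 oppr0 mxE.
Qed.

(** Each requirement holds for all small [e > 0] and there are finitely many tuples, so one [e]
    below [delta] meets them all. The all-ones vector witnesses positivity of each form. *)
Lemma strict_perturbation d c (delta : R) : (2 <= d)%N ->
  (forall m, mdeg m = d -> 0 < c m) ->
  (forall m, mdeg m = (d - 2)%N -> lorentzian_form (hess_form c m)) ->
  0 < delta -> exists e : R, 0 < e < delta /\
    strictly_lorentzian d (mpoly_of d (fun m => c m - e * power_sum m)).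
Proof.
move=> d2 c0 lorc delta0; pose P := power_sum.
have hessB e m : hess_mx (fun m => c m - e * P m) m =
    hess_mx c m - e *: hess_mx P m.
  by apply/matrixP => i j; rewrite !mxE.
pose one : 'rV[R]_n := const_mx 1.
have near_pos : \forall e \near (0 : R)^'+,
    forall t : d.-tuple 'I_n, 0 < c (s2m t) - e * P (s2m t).
  apply: filter_forall => t; have deg_t : mdeg (s2m t) = d.
    by rewrite mdeg_s2m size_tuple.
  apply: filterS (nbhs_right_lt (_ : 0 < c (s2m t) / P (s2m t))) => [e|].
    by rewrite subr_gt0 ltr_pdivlMr // power_sum_gt0.
  by rewrite divr_gt0 ?c0 // power_sum_gt0.
have near_hess : \forall e \near (0 : R)^'+, forall t : (d - 2).-tuple 'I_n,
    hess_mx c (s2m t) - e *: hess_mx P (s2m t) \in unitmx /\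
    num_pos_eigenvalues (hess_mx c (s2m t) - e *: hess_mx P (s2m t)) = 1%N.
  apply: filter_forall => t; have deg_t : mdeg (s2m t) = (d - 2)%N.
    by rewrite mdeg_s2m size_tuple.
  apply: (near_perturb_lorentzian (x := one)).
  - exact: tr_hess_mx.
  - exact: tr_hess_mx.
  - exact: power_sum_posdef.
  - by rewrite -hess_formEfun; apply: lorc.
  have entry_gt0 i j : 0 < one 0 i * hess_mx c (s2m t) i j * one 0 j.
    by rewrite !mxE mul1r mulr1 c0 // !mdegD !mdeg1 deg_t; lia.
  have i0 : 'I_n := Ordinal n_gt0.
  apply/psumr_gt0P => [i|]; first by apply: sumr_ge0 => j _; exact: ltW.
  exists i0; apply/psumr_gt0P => [j|]; first exact: ltW.
  by exists i0.
have [e [[e0 e_delta] [pos_e hess_e]]] :=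
  filter_ex (filterI (filterI (nbhs_right_gt 0) (nbhs_right_lt delta0))
    (filterI near_pos near_hess)).
exists e; split; first by rewrite e0.
set F := mpoly_of d _.
have cF m : mdeg m = d -> nmcoeff F m = c m - e * P m.
  exact: nmcoeff_mpoly_of.
split=> [|t|_ t]; first exact: homogeneous_mpoly_of.
  by rewrite mcoeff0_pderivs cF ?pos_e // mdeg_s2m size_tuple.
rewrite second_form_mxE; suff -> : hess_mx (nmcoeff F) (s2m t) =
    hess_mx c (s2m t) - e *: hess_mx P (s2m t) by exact: hess_e.
rewrite -hessB; apply/matrixP => i j; rewrite !mxE cF //.
by rewrite !mdegD !mdeg1 mdeg_s2m size_tuple; lia.
Qed.

Lemma lorentzian_approx d (f : mpoly n R) (ck : nat -> multinom n -> R) :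
  (2 <= d)%N -> homogeneous d f ->
  (forall k m, mdeg m = d -> 0 < ck k m) ->
  (forall k m, mdeg m = (d - 2)%N -> lorentzian_form (hess_form (ck k) m)) ->
  (forall m, mdeg m = d -> ck k m @[k --> \oo] --> nmcoeff f m) ->
  lorentzian d f.
Proof.
move=> d2 homf c0 lorc cvgc; split=> //.
have harm0 k : 0 < harmonic k :> R by rewrite invr_gt0.
have [e e_strict] := choice (fun k =>
  strict_perturbation d2 (c0 k) (lorc k) (harm0 k)).
exists (fun k => mpoly_of d (fun m => ck k m - e k * power_sum m)).
split=> [k|m]; first by have [] := e_strict k.
have cvge : e k @[k --> \oo] --> 0.
  apply: (@squeeze_cvgr _ _ _ _ (fun=> 0) harmonic).
  - by near=> k; have [/andP[e0 e1] _] := e_strict k; rewrite !ltW.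
  - exact: cvg_cst.
  - exact: cvg_harmonic.
have mcoeffE (g : mpoly n R) : mcoeff m g = nmcoeff g m / (mnm_fact m)%:R.
  rewrite /nmcoeff -[mcoeff m g *+ _]mulr_natr mulfK //.
  by rewrite pnatr_eq0 gtn_eqF ?mnm_fact_gt0.
rewrite mcoeffE; under eq_fun do rewrite mcoeffE.
apply: cvgM; last exact: cvg_cst.
have [degm|degm] := eqVneq (mdeg m) d; last first.
  rewrite (homogeneous_nmcoeff homf) //; under eq_fun do
    rewrite (homogeneous_nmcoeff (homogeneous_mpoly_of _ _)) //.
  exact: cvg_cst.
under eq_fun do rewrite nmcoeff_mpoly_of //.
have := cvgB (cvgc m degm) (cvgM cvge (cvg_cst (power_sum m))).
by rewrite mul0r subr0; apply.
Unshelve. all: by end_near. Qed.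

(** The approximants are the multiples [harmonic k] of (t_1 + ... + t_n)^d / d!, whose second order
    forms have rank one. *)
Lemma lorentzian0 d : (2 <= d)%N -> lorentzian d (0 : mpoly n R).
Proof.
move=> d2; apply: (@lorentzian_approx _ _ (fun k _ => harmonic k)) => //.
- exact: dhomog0.
- by move=> k m _; rewrite invr_gt0.
- move=> k m _ x y _.
  have hessE u v : hess_form (fun=> harmonic k) m u v =
      (\sum_i u 0 i) * (\sum_i v 0 i) * harmonic k :> R.
    rewrite /hess_form /shift_deriv -mulrA mulr_suml; apply: eq_bigr => i _.
    by congr (_ * _); rewrite mulr_suml.
  by rewrite !hessE le_eqVlt; apply/orP; left; apply/eqP; ring.
- by move=> m _; rewrite /nmcoeff mcoeff0 mul0rn; exact: cvg_harmonic.
Qed.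

Lemma H_connected_lorentzian d (f : mpoly n R) : (2 <= d)%N ->
  homogeneous d f -> (forall m, 0 <= mcoeff m f) ->
  H_connected (tau (supp d f)) ->
  (forall i : (d - 2).-tuple 'I_n,
     (num_pos_eigenvalues (second_form_mx (pderivs i f)) <= 1)%N) ->
  lorentzian d f.
Proof.
move=> d2 homf f0 [r [sum_r conn]] num1.
(* For [f = 0] the support is empty, so it does not determine [r], and no substitution makes the
   coefficients positive. *)
have [->|/eqP fn0] := eqVneq f 0; first exact: lorentzian0.
have suppE a := supp_nmcoeff a homf f0.
set c := nmcoeff f; have c0 a : 0 <= c a by rewrite nmcoeff_ge0.
have [m0 [deg0 cm0]] : exists m, mdeg m = d /\ 0 < c m.
  apply: contrapT => nm; apply: fn0; apply/mpolyP => m; rewrite mcoeff0.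
  apply/eqP; rewrite -nmcoeff_eq0; have [degm|degm] := eqVneq (mdeg m) d.
    rewrite eq_le c0 andbT leNgt; apply/negP => cm; apply: nm.
    by exists m.
  by rewrite (homogeneous_nmcoeff homf).
have rE : r = d.-1.
  have [|i [b eqm0]] := @mdeg_gt0_split _ m0; first by rewrite deg0; lia.
  rewrite -(sum_r b); last by apply/tauE; exists i; rewrite -eqm0; apply/suppE.
  by rewrite -deg0 eqm0 mdeg_mnm1D.
have lorc m : mdeg m = (d - 2)%N -> lorentzian_form (hess_form c m).
  move=> degm; have /eqP sz : size (m2s m) = (d - 2)%N by rewrite size_m2s.
  rewrite hess_formEfun; apply/num_pos_le1P; first exact: tr_hess_mx.
  by have := num1 (Tuple sz); rewrite second_form_mxE s2mK.
(* Positive directions tending to the standard basis: they spread the positive coefficient at [m0]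
   to every exponent of degree [d]. *)
pose a k i : 'rV[R]_n := delta_mx 0 i + const_mx (harmonic k).
have a0 k i : positive_vector (a k i).
  by move=> j; rewrite !mxE ltr_wpDl // invr_gt0.
have a0s k (s : seq 'I_n) v : v \in [seq a k i | i <- s] -> positive_vector v.
  by move=> /mapP[i _ ->].
apply: (@lorentzian_approx _ _ (fun k => linear_subst (a k) c)) => //.
- move=> k m degm; apply/shift_derivs_gt0 => //; first exact: a0s.
  exists m0; split; last by rewrite add0m.
  by rewrite size_map size_m2s degm.
- move=> k m degm x y; rewrite !hess_form_linear_subst.
  apply: (@lorentzian_hess_positive _ _ _ (d - 2)) => //; last 2 first.
  + exact: a0s.
  + by rewrite size_map size_m2s degm mdeg0.
  move=> vs b vs0 vs_gt0 degb.
  have degb2 : (mdeg b + size vs + 2)%N = d by rewrite degb subnK.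
  apply/(set_connected_hess c0 suppE vs0 vs_gt0 degb2).
  by apply: conn; rewrite rE; lia.
move=> m _; apply: cvg_linear_subst => i j.
rewrite /a; under eq_fun do rewrite mxE [const_mx _ _ _]mxE.
have := cvgD (cvg_cst ((delta_mx 0 i : 'rV[R]_n) 0 j)) (@cvg_harmonic R).
by rewrite addr0; apply.
Qed.

End Sufficiency.

Theorem theorem8p4 (R : realType) (n : nat) (n_ge1 : (1 <= n)%N)
  (d : nat) (d_ge2 : (2 <= d)%N) (f : mpoly n R)
  (f_homog : homogeneous d f)
  (f_ge0 : forall m : multinom n, 0 <= mcoeff m f) :
  lorentzian d f <->
  (H_connected (tau (supp d f)) /\
   forall i : (d - 2).-tuple 'I_n,
     (num_pos_eigenvalues (second_form_mx (pderivs i f)) <= 1)%N).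
Proof.
split=> [lorf|[conn num1]]; last exact: H_connected_lorentzian.
split=> [|i]; first exact: lorentzian_H_connected.
exact: lorentzian_num_pos.
Qed.
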